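(* Let $\mathcal{J}$ be a small category and let $(M,\mu)$ be a crossed $\mathcal{J}$-module. Then there is a category $M\mathcal{J}$ whose objects are those of $\mathcal{J}$, whose hom-sets are $$M\mathcal{J}(j,k)=\{(a,f)\in M(k)\times\mathcal{J}(j,k)\mid \mu_k(a)f=f\},$$ and whose composition $M\mathcal{J}(k,l)\times M\mathcal{J}(j,k)\to M\mathcal{J}(j,l)$ is $$(b,g)\circ(a,f)=\bigl(b\cdot g_\ast a,\ \mu_l(g_\ast a)\,g f\bigr).$$
   Context: $\mathbf{Mon}$ is the category of monoids. A crossed $\mathcal{J}$-module is a functor $M:\mathcal{J}\to\mathbf{Mon}$ (write $f_\ast=M(f)$) together with monoid homomorphisms $\mu_j:M(j)\to\mathrm{End}_{\mathcal{J}}(j)$ for $j\in\mathcal{J}$ such that for every $f:j\to k$ in $\mathcal{J}$ and $a,b\in M(j)$: (CM1) $\mu_k(f_\ast a)\, f\,\mu_j(a)=\mu_k(f_\ast a)^2 f$; (CM2) $ab=(\mu_j(a)_\ast b)\,a$. *)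

(* Defs.v *)
From Stdlib Require Import FunctionalExtensionality ProofIrrelevance.

Set Implicit Arguments.
Unset Strict Implicit.
Unset Printing Implicit Defensive.

(** ** Monoids

    MathComp's [monoidType] is not used: it requires a choice structure on the
    carrier, which an endomorphism monoid of an arbitrary category lacks. *)

Record monoid : Type := Monoid {
  carrier :> Type;
  one : carrier;
  mul : carrier -> carrier -> carrier;
  mulA : forall a b c, mul a (mul b c) = mul (mul a b) c;
  mul1m : forall a, mul one a = a;
  mulm1 : forall a, mul a one = a
}.

Arguments one {m}.
Arguments mul {m} a b.

Declare Scope monoid_scope.
Delimit Scope monoid_scope with M.
Notation "1" := one : monoid_scope.
Infix "*" := mul : monoid_scope.
Open Scope monoid_scope.

Record monoid_hom (A B : monoid) : Type := MonoidHom {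
  hom_fun :> A -> B;
  hom_one : hom_fun 1 = 1;
  hom_mul : forall a b, hom_fun (a * b) = hom_fun a * hom_fun b
}.

Lemma monoid_hom_eq (A B : monoid) (u v : monoid_hom A B) :
  (forall a, u a = v a) -> u = v.
Proof.
destruct u as [u u1 uM]; destruct v as [v v1 vM]; simpl; intros E.
assert (E' : u = v) by (apply functional_extensionality; exact E).
subst v; f_equal; apply proof_irrelevance.
Qed.

Definition monoid_hom_id (A : monoid) : monoid_hom A A :=
  @MonoidHom A A (fun a => a) eq_refl (fun _ _ => eq_refl).

Lemma monoid_hom_comp_one (A B C : monoid)
  (v : monoid_hom B C) (u : monoid_hom A B) : v (u 1) = 1.
Proof. rewrite !hom_one; reflexivity. Qed.

Lemma monoid_hom_comp_mul (A B C : monoid)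
  (v : monoid_hom B C) (u : monoid_hom A B) (a b : A) :
  v (u (a * b)) = v (u a) * v (u b).
Proof. rewrite !hom_mul; reflexivity. Qed.

Definition monoid_hom_comp (A B C : monoid)
  (v : monoid_hom B C) (u : monoid_hom A B) : monoid_hom A C :=
  MonoidHom (monoid_hom_comp_one v u) (monoid_hom_comp_mul v u).

(** ** Categories

    [category_on hom] is the structure turning a given family of hom-sets into
    a category, so that a category with prescribed objects and hom-sets is an
    inhabitant of it. Composition is in the order [comp g f] = "g after f". *)

Record category_on (Ob : Type) (Hom : Ob -> Ob -> Type) : Type := CategoryOn {
  cat_id : forall j, Hom j j;
  cat_comp : forall j k l, Hom k l -> Hom j k -> Hom j l;
  cat_compA : forall i j k l (h : Hom k l) (g : Hom j k) (f : Hom i j),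
    cat_comp h (cat_comp g f) = cat_comp (cat_comp h g) f;
  cat_id_comp : forall j k (f : Hom j k), cat_comp (cat_id k) f = f;
  cat_comp_id : forall j k (f : Hom j k), cat_comp f (cat_id j) = f
}.

Record category : Type := Category {
  obj :> Type;
  hom : obj -> obj -> Type;
  cat_str : category_on hom
}.

Definition idm (C : category) (j : C) : hom j j := cat_id (cat_str C) j.

Definition comp (C : category) (j k l : C) (g : hom k l) (f : hom j k) :
  hom j l := cat_comp (cat_str C) g f.

Declare Scope cat_scope.
Notation "g '∘' f" := (comp g f)
  (at level 40, left associativity) : cat_scope.
Open Scope cat_scope.

Record functor (C D : category) : Type := Functor {
  fobj :> C -> D;
  fmap : forall j k : C, hom j k -> hom (fobj j) (fobj k);
  fmap_id : forall j : C, fmap (idm j) = idm (fobj j);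
  fmap_comp : forall (j k l : C) (g : hom k l) (f : hom j k),
    fmap (g ∘ f) = fmap g ∘ fmap f
}.

Definition Mon_on : category_on monoid_hom.
Proof.
refine (@CategoryOn monoid monoid_hom monoid_hom_id monoid_hom_comp _ _ _);
  intros; apply monoid_hom_eq; reflexivity.
Defined.

Definition Mon : category := Category Mon_on.

Definition End (C : category) (j : C) : monoid :=
  @Monoid (hom j j) (idm j) (fun g f => g ∘ f)
    (fun h g f => cat_compA (cat_str C) h g f)
    (fun f => cat_id_comp (cat_str C) f)
    (fun f => cat_comp_id (cat_str C) f).

(** ** Crossed modules over a category *)

Definition elt (J : category) (M : functor J Mon) (j : J) : monoid := M j.

(* [push M f a] is f_* a. *)
Definition push (J : category) (M : functor J Mon) (j k : J) (f : hom j k) :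
  monoid_hom (elt M j) (elt M k) := fmap M f.

Record crossed_module (J : category) : Type := CrossedModule {
  cm_functor :> functor J Mon;
  cm_mu : forall j : J, monoid_hom (elt cm_functor j) (End j);
  cm1 : forall (j k : J) (f : hom j k) (a : elt cm_functor j),
    let p : hom k k := cm_mu k (push cm_functor f a) in
    let q : hom j j := cm_mu j a in
    p ∘ f ∘ q = p ∘ p ∘ f;
  cm2 : forall (j : J) (a b : elt cm_functor j),
    a * b = push cm_functor (cm_mu j a : hom j j) b * a
}.

Definition mu (J : category) (M : crossed_module J) (j : J) (a : elt M j) :
  hom j j := cm_mu M j a.

Definition MJ_hom (J : category) (M : crossed_module J) (j k : J) : Type :=
  { p : elt M k * hom j k | mu (fst p) ∘ snd p = snd p }.

Definition MJ_elt (J : category) (M : crossed_module J) (j k : J)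
  (p : MJ_hom M j k) : elt M k := fst (proj1_sig p).

Definition MJ_arr (J : category) (M : crossed_module J) (j k : J)
  (p : MJ_hom M j k) : hom j k := snd (proj1_sig p).

(* Main.v *)
Require Import Defs.
From Stdlib Require Import ProofIrrelevance.

Set Implicit Arguments.
Unset Strict Implicit.

(** Everything reduces to what happens when one hom-condition meets the two
    crossed module axioms.  Here an element [a] also stands for the
    endomorphism [mu a], and it fixes an arrow [f] when [mu a ∘ f = f].

    - If [b] fixes [g], then (CM2) reads [b * g_* a = (b ∘ g)_* a * b =
      g_* a * b]: the two factors of the first component of a composite
      commute ([fixer_push_commute]).
    - If [a] fixes [f], then precomposing (CM1) for [g] with [f] shows that
      [g_* a] fixes [g_* a ∘ g ∘ f] ([push_fixer_idem]).

    Together they say that [b * g_* a] fixes [g_* a ∘ g ∘ f], so composition is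
    well defined.  The unit laws are immediate: the left one is exactly the
    hom-condition.

    For associativity of [(c,h)], [(b,g)], [(a,f)] put [x = h_* b] and
    [y = (h ∘ g)_* a].  One bracketing has the first component [c * (x * y)]
    and the other [c * (x * x_* y)].  Since [b] fixes [g], the second fact
    gives [x ∘ x ∘ h ∘ g = x ∘ h ∘ g], hence [x_* (x_* y) = x_* y], and two
    uses of (CM2) give [x * x_* y = x_* y * x = x * y] ([push_fixer_absorb]).
    The second components both reduce to [x * y] applied to [h ∘ g ∘ f]. *)

Section CrossedModule.

Variables (J : category) (M : crossed_module J).

Lemma compA (i j k l : J) (h : hom k l) (g : hom j k) (f : hom i j) :
  h ∘ (g ∘ f) = h ∘ g ∘ f.
Proof. apply cat_compA. Qed.

Lemma id_comp (j k : J) (f : hom j k) : idm k ∘ f = f.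
Proof. apply cat_id_comp. Qed.

Lemma comp_id (j k : J) (f : hom j k) : f ∘ idm j = f.
Proof. apply cat_comp_id. Qed.

Lemma push_id (j : J) (a : elt M j) : push M (idm j) a = a.
Proof. unfold push; rewrite fmap_id; reflexivity. Qed.

Lemma push_comp (j k l : J) (g : hom k l) (f : hom j k) (a : elt M j) :
  push M (g ∘ f) a = push M g (push M f a).
Proof. unfold push; rewrite fmap_comp; reflexivity. Qed.

Lemma mu_one (j : J) : mu (1 : elt M j) = idm j.
Proof. exact (hom_one (cm_mu M j)). Qed.

Lemma mu_mul (j : J) (a b : elt M j) : mu (a * b) = mu a ∘ mu b.
Proof. exact (hom_mul (cm_mu M j) a b). Qed.

Lemma mu_push_comp (j k : J) (f : hom j k) (a : elt M j) :
  mu (push M f a) ∘ f ∘ mu a = mu (push M f a) ∘ mu (push M f a) ∘ f.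
Proof. exact (cm1 f a). Qed.

Lemma mul_push_mu (j : J) (a b : elt M j) :
  a * b = push M (mu a) b * a.
Proof. exact (cm2 a b). Qed.

(** By (CM2), moving [b] past [g_* a] replaces [g] by [mu b ∘ g]. *)
Lemma fixer_push_commute (j k : J) (g : hom j k) (b : elt M k)
    (a : elt M j) :
  mu b ∘ g = g -> b * push M g a = push M g a * b.
Proof.
intros bg; rewrite mul_push_mu, <- push_comp, bg; reflexivity.
Qed.

(** This is (CM1) for [g] and [a], precomposed with [f]. *)
Lemma push_fixer_idem (i j k : J) (g : hom j k) (f : hom i j)
    (a : elt M j) :
  mu a ∘ f = f ->
  mu (push M g a) ∘ (mu (push M g a) ∘ g ∘ f) = mu (push M g a) ∘ g ∘ f.
Proof.
intros af.
rewrite !compA, <- mu_push_comp, <- (compA _ (mu a) f), af; reflexivity.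
Qed.

(** With [x = h_* b] and [y = (h ∘ g)_* a], [push_fixer_idem] makes [x_*]
    idempotent on [y], so that [x * x_* y = x_* (x_* y) * x = x_* y * x
    = x * y]. *)
Lemma push_fixer_absorb (i j k : J) (h : hom j k) (g : hom i j)
    (b : elt M j) (a : elt M i) :
  mu b ∘ g = g ->
  push M h b * push M (mu (push M h b) ∘ h ∘ g) a
    = push M h b * push M h (push M g a).
Proof.
intros bg.
rewrite mul_push_mu, <- push_comp, (push_fixer_idem h bg).
rewrite !push_comp, <- mul_push_mu; reflexivity.
Qed.

Lemma MJ_hom_eq (j k : J) (p q : MJ_hom M j k) :
  proj1_sig p = proj1_sig q -> p = q.
Proof.
destruct p as [p Hp], q as [q Hq]; simpl; intros E; subst q.
f_equal; apply proof_irrelevance.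
Qed.

(** The extra factor [g_* a] is absorbed by [push_fixer_idem]; then [b], which
    commutes with [g_* a], moves past it and is absorbed by [g]. *)
Lemma MJ_comp_fixes (j k l : J) (g : hom k l) (f : hom j k)
    (b : elt M l) (a : elt M k) :
  mu b ∘ g = g -> mu a ∘ f = f ->
  mu (b * push M g a) ∘ (mu (push M g a) ∘ g ∘ f)
    = mu (push M g a) ∘ g ∘ f.
Proof.
intros bg af.
rewrite mu_mul, <- compA, (push_fixer_idem g af).
rewrite !compA, <- mu_mul, (fixer_push_commute a bg), mu_mul.
rewrite <- (compA _ (mu b) g), bg; reflexivity.
Qed.

Definition MJ_comp (j k l : J) (q : MJ_hom M k l) (p : MJ_hom M j k) :
  MJ_hom M j l :=
  exist _
    (MJ_elt q * push M (MJ_arr q) (MJ_elt p),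
     mu (push M (MJ_arr q) (MJ_elt p)) ∘ MJ_arr q ∘ MJ_arr p)
    (MJ_comp_fixes (proj2_sig q) (proj2_sig p)).

Lemma MJ_id_fixes (j : J) : mu (1 : elt M j) ∘ idm j = idm j.
Proof. rewrite mu_one; apply id_comp. Qed.

Definition MJ_id (j : J) : MJ_hom M j j :=
  exist _ (1, idm j) (MJ_id_fixes j).

Lemma MJ_id_comp (j k : J) (p : MJ_hom M j k) : MJ_comp (MJ_id k) p = p.
Proof.
destruct p as [[a f] af]; apply MJ_hom_eq; cbn in *.
rewrite push_id, mul1m, comp_id, af; reflexivity.
Qed.

Lemma MJ_comp_id (j k : J) (p : MJ_hom M j k) : MJ_comp p (MJ_id j) = p.
Proof.
destruct p as [[a f] af]; apply MJ_hom_eq; cbn in *.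
rewrite hom_one, mulm1, mu_one, id_comp, comp_id; reflexivity.
Qed.

(** In both bracketings the arrow is [mu (x * y) ∘ h ∘ g ∘ f], where
    [x = h_* b] and [y = (h ∘ g)_* a]. *)
Lemma MJ_compA (i j k l : J) (r : MJ_hom M k l) (q : MJ_hom M j k)
    (p : MJ_hom M i j) :
  MJ_comp r (MJ_comp q p) = MJ_comp (MJ_comp r q) p.
Proof.
destruct r as [[c h] ch], q as [[b g] bg], p as [[a f] af].
apply MJ_hom_eq; cbn in *; f_equal.
- rewrite hom_mul, <- mulA, push_fixer_absorb by exact bg; reflexivity.
- rewrite hom_mul, mu_mul.
  (* (CM1) for [h] and [g_* a] turns the inner [g_* a] into a second [y],
     which [push_fixer_idem] absorbs. *)
  assert (L : mu (push M h (push M g a)) ∘ h ∘ (mu (push M g a) ∘ g ∘ f)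
              = mu (push M h (push M g a)) ∘ (h ∘ g ∘ f)).
  { pose proof (push_fixer_idem (h ∘ g) af) as E.
    rewrite push_comp, !compA in E.
    rewrite !compA, mu_push_comp; exact E. }
  (* By (CM2), the fixing element on the right is [x_* y * x = x * y]. *)
  assert (R : mu (push M (mu (push M h b) ∘ h ∘ g) a) ∘ mu (push M h b)
              = mu (push M h b) ∘ mu (push M h (push M g a))).
  { rewrite <- !mu_mul, !push_comp, <- mul_push_mu; reflexivity. }
  transitivity (mu (push M h b) ∘ mu (push M h (push M g a)) ∘ (h ∘ g ∘ f)).
  + rewrite <- (compA _ _ h), <- (compA _ (_ ∘ h)), L; apply compA.
  + rewrite <- R, !compA; reflexivity.
Qed.

Definition MJ_on : category_on (MJ_hom M) :=
  CategoryOn MJ_compA MJ_id_comp MJ_comp_id.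

End CrossedModule.

Theorem corollary7p6 (J : category) (M : crossed_module J) :
  exists MJ : category_on (MJ_hom M),
    forall (j k l : J) (q : MJ_hom M k l) (p : MJ_hom M j k),
      let a := MJ_elt p in let f := MJ_arr p in
      let b := MJ_elt q in let g := MJ_arr q in
      proj1_sig (cat_comp MJ q p) =
        (b * push M g a, mu (push M g a) ∘ g ∘ f).
Proof. exists (MJ_on M); reflexivity. Qed.
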